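(* Let $M, d \ge 1$ be integers, let $x_1,\dots,x_M$ be the elements of a finite set, let $w_1,\dots,w_M \in \mathbb{R}^d$ be fixed vectors, and let $P^*$ be a probability distribution on $\{x_1,\dots,x_M\}$. For $h\in\mathbb{R}^d$ let $Q_h$ be the probability distribution $$Q_h(x_i) = \frac{\exp(\langle w_i, h\rangle)}{\sum_{j=1}^M \exp(\langle w_j, h\rangle)}.$$ Then: (i) $H(P^*,Q) \ge H(P^* )$ for every probability distribution $Q$ on $\{x_1,\dots,x_M\}$ (not necessarily of the form $Q_h$). (ii) $$\min_{h \in \mathbb{R}^d} H(P^*,Q_h) = \max_{R \in \mathcal{P}^*} H(R),$$ where $$\mathcal{P}^* = \Big\{R : R \ge 0,\ \sum_{i=1}^M R(x_i) = 1,\ \mathbb{E}_{R}[w] = \mathbb{E}_{P^*}[w]\Big\}$$ is a convex polytope defined by $d+1$ linear constraints.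
   Context: For a probability distribution $R$ on $\{x_1,\dots,x_M\}$, $\mathbb{E}_R[w] := \sum_{i=1}^M R(x_i)\, w_i \in \mathbb{R}^d$, and $R \ge 0$ means $R(x_i)\ge 0$ for all $i$. The entropy is $H(R) = -\sum_{i=1}^M R(x_i)\log R(x_i)$, and the cross entropy of $R$ and $Q$ is $H(R,Q) = \mathbb{E}_R[-\log Q] = -\sum_{i=1}^M R(x_i)\log Q(x_i)$, with the usual conventions $0\log 0 = 0$ and $H(R,Q) = +\infty$ if $Q(x_i)=0<R(x_i)$ for some $i$.
   Formalization: The minimum over h is stated as an infimum, because it need not be attained (M=2, d=1, w=(0,1), P*=(1,0) gives log(1+e^h), with infimum 0 not attained); whenever the minimum exists, the stated equality follows. *)

(* Defs.v *)
From HB Require Import structures.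
From mathcomp Require Import all_boot all_order all_algebra.
From mathcomp Require Import all_classical all_reals all_analysis.

Set Implicit Arguments.
Unset Strict Implicit.
Unset Printing Implicit Defensive.

Import Order.TTheory GRing.Theory Num.Theory.

Local Open Scope classical_set_scope.
Local Open Scope ring_scope.

(* The M-element set {x_1, ..., x_M} is 'I_M (x_i is i), and a function on it
   is a row vector p, with p(x_i) written p 0 i. *)

Definition is_distr (R : realType) (M : nat) (p : 'rV[R]_M) : Prop :=
  (forall i, 0 <= p 0 i) /\ \sum_i p 0 i = 1.

Definition expect (R : realType) (M : nat) (V : lmodType R)
    (p : 'rV[R]_M) (w : 'I_M -> V) : V :=
  \sum_i p 0 i *: w i.

(* 0 log 0 = 0 holds because of the factor 0. *)
Definition entropy (R : realType) (M : nat) (p : 'rV[R]_M) : R :=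
  - \sum_i p 0 i * ln (p 0 i).

(* lne 0 = -oo and 0 * -oo = 0 in \bar R, so a term vanishes when p(x_i) = 0,
   and the value is +oo as soon as q(x_i) = 0 < p(x_i) for some i. *)
Definition cross_entropy (R : realType) (M : nat) (p q : 'rV[R]_M) : \bar R :=
  (- \sum_i (p 0 i)%:E * lne (q 0 i)%:E)%E.

Definition dotv (R : realType) (d : nat) (u v : 'rV[R]_d) : R :=
  \sum_k u 0 k * v 0 k.

Definition gibbs (R : realType) (M d : nat) (w : 'I_M -> 'rV[R]_d)
    (h : 'rV[R]_d) : 'rV[R]_M :=
  \row_i (expR (dotv (w i) h) / \sum_j expR (dotv (w j) h)).

(* The set written calligraphic P^*. *)
Definition moment_polytope (R : realType) (M d : nat) (w : 'I_M -> 'rV[R]_d)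
    (pstar : 'rV[R]_M) : set 'rV[R]_M :=
  [set r : 'rV[R]_M | is_distr r /\ expect r w = expect pstar w].

(* The weights of a convex combination form a probability distribution, so the
   convex hull of v is the set of its expectations. *)
Definition conv_hull (R : realType) (V : lmodType R) (n : nat) (v : 'I_n -> V)
    : set V :=
  [set expect c v | c in [set c : 'rV[R]_n | is_distr c]].

Definition convex_polytope (R : realType) (V : lmodType R) (A : set V) : Prop :=
  exists (n : nat) (v : 'I_n -> V), A = conv_hull v.

(* A is cut out of the nonnegative orthant by m linear equations, one for each
   column of C. *)
Definition defined_by_linear_constraints (R : realType) (M m : nat)
    (A : set 'rV[R]_M) : Prop :=
  exists (C : 'M[R]_(M, m)) (b : 'rV[R]_m),
    A = [set r : 'rV[R]_M | (forall i, 0 <= r 0 i) /\ r *m C = b].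

(* Main.v *)
(* Weak duality: for r with the moment of P*, H(P*, Q_h) = H(r, Q_h) >= H(r).
   Conversely let L(h) = H(P*, Q_h). The infimum of L need not be attained, but
   L(h) + e/2 |h|^2 has a minimiser h for every e > 0, and stationarity there
   reads E_{Q_h}[w] = E_{P*}[w] - e h. Hence H(Q_h) = L(h) + e |h|^2 >= inf L,
   while the squared moment gap e^2 |h|^2 is O(e). By compactness of the simplex
   and continuity of the entropy, some r with the exact moment has
   H(r) >= inf L, so weak duality makes r optimal and the values equal. *)

Require Import Defs.
From HB Require Import structures.
From mathcomp Require Import all_boot all_order all_algebra.
From mathcomp Require Import all_classical all_reals all_analysis.
From mathcomp Require Import ring lra.

Set Implicit Arguments.
Unset Strict Implicit.
Unset Printing Implicit Defensive.

Import Order.TTheory GRing.Theory Num.Theory.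
Import numFieldNormedType.Exports.

Local Open Scope classical_set_scope.
Local Open Scope ring_scope.

(** * Convex combinations and convex hulls *)

Lemma is_distr_delta (R : realType) (n : nat) (k : 'I_n) :
  is_distr (delta_mx 0 k : 'rV[R]_n).
Proof.
split=> [i|]; first by rewrite mxE; case: (_ && _).
rewrite (bigD1 k) //= big1 ?addr0 => [|i /negPf ik]; by rewrite mxE ?ik ?eqxx.
Qed.

Lemma expect_delta (R : realType) (V : lmodType R) (n : nat) (v : 'I_n -> V)
  (k : 'I_n) : expect (delta_mx 0 k) v = v k.
Proof.
rewrite /expect (bigD1 k) //= big1 ?addr0 => [|i /negPf ik].
  by rewrite mxE !eqxx scale1r.
by rewrite mxE ik scale0r.
Qed.

Lemma expectD (R : realType) (V : lmodType R) (n : nat) (v : 'I_n -> V)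
  (a b : R) (p q : 'rV[R]_n) :
  expect (a *: p + b *: q) v = a *: expect p v + b *: expect q v.
Proof.
rewrite /expect !scaler_sumr -big_split /=; apply: eq_bigr => i _.
by rewrite !mxE !scalerA -scalerDl.
Qed.

Lemma is_distr_convex (R : realType) (n : nat) (a b : R) (p q : 'rV[R]_n) :
  0 <= a -> 0 <= b -> a + b = 1 -> is_distr p -> is_distr q ->
  is_distr (a *: p + b *: q).
Proof.
move=> a0 b0 ab [p0 p1] [q0 q1]; split=> [i|].
  by rewrite !mxE addr_ge0 ?mulr_ge0.
under eq_bigr do rewrite !mxE.
by rewrite big_split /= -!mulr_sumr p1 q1 !mulr1.
Qed.

Lemma conv_hull_convex (R : realType) (V : lmodType R) (n : nat)
  (v : 'I_n -> V) (a b : R) (x y : V) :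
  0 <= a -> 0 <= b -> a + b = 1 -> conv_hull v x -> conv_hull v y ->
  conv_hull v (a *: x + b *: y).
Proof.
move=> a0 b0 ab [p pd <-] [q qd <-]; exists (a *: p + b *: q).
  exact: is_distr_convex.
exact: expectD.
Qed.

(** * Polytopes of distributions cut out by linear equations *)

Definition support (R : realType) (M : nat) (r : 'rV[R]_M) : {set 'I_M} :=
  finset (fun i => r 0 i != 0).

(** Walk from [r] along [u] until the first coordinate reaches 0. Coordinates that vanish in [r] are
    not moved, so the support can only shrink. *)
Lemma move_to_boundary (R : realType) (M : nat) (r u : 'rV[R]_M) :
  (forall i, 0 <= r 0 i) -> (forall i, r 0 i = 0 -> u 0 i = 0) ->
  (exists i, u 0 i < 0) ->
  exists2 t : R, 0 < t & (forall i, 0 <= (r + t *: u) 0 i) /\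
    support (r + t *: u) \proper support r.
Proof.
move=> r0 ru [i0 ui0].
(* Ratio test: coordinate [i] with [u 0 i < 0] vanishes at time [r 0 i / - u 0 i], and [j] is the
   first to do so. *)
pose j := [arg min_(i < i0 | u 0 i < 0) (r 0 i / - u 0 i)]%O.
have [uj jmin] : u 0 j < 0 /\
    forall i, u 0 i < 0 -> r 0 j / - u 0 j <= r 0 i / - u 0 i.
  by rewrite /j; case: Order.TotalTheory.arg_minP.
have rj : 0 < r 0 j.
  rewrite lt_neqAle r0 andbT eq_sym; apply/eqP => /ru uj0.
  by rewrite uj0 ltxx in uj.
exists (r 0 j / - u 0 j); first by rewrite divr_gt0 ?oppr_gt0.
set t := _ / _.
have t0 : 0 < t by rewrite divr_gt0 ?oppr_gt0.
split=> [i|].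
  rewrite !mxE; have [ui|ui] := ltP (u 0 i) 0.
    have := jmin i ui; rewrite -/t ler_pdivlMr ?oppr_gt0 //.
    by rewrite mulrN -subr_ge0 opprK.
  by rewrite addr_ge0 // mulr_ge0 // ltW.
apply/properP; split.
  apply/fintype.subsetP => i; rewrite !inE !mxE; apply: contraNN => /eqP ri.
  by rewrite ri (ru _ ri) mulr0 addr0.
exists j; first by rewrite inE gt_eqF.
rewrite inE negbK !mxE /t.
by apply/eqP; field; rewrite lt_eqF.
Qed.

(* Every point is either the only point of A with its support, or lies inside a
   segment of A whose endpoints have smaller support; so A is the convex hull
   of the points of the first kind, of which there is at most one for each of
   the finitely many supports. *)
Lemma constrained_distr_polytope (R : realType) (M m : nat) (C : 'M[R]_(M, m))
  (b : 'rV[R]_m) (a : 'rV[R]_M) :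
  is_distr a -> a *m C = b ->
  convex_polytope [set r : 'rV[R]_M | is_distr r /\ r *m C = b].
Proof.
set A := (X in convex_polytope X) => ad aC.
have Aa : A a by [].
pose lone (r : 'rV[R]_M) :=
  forall s, A s -> support s \subset support r -> s = r.
(* Two lone points with the same support coincide, so choosing one per support loses none. For a
   support without a lone point the default [a] is taken, which still lies in [A]. *)
pose v (k : 'I_#|{set 'I_M}|) : 'rV[R]_M :=
  xget a [set r : 'rV[R]_M | [/\ A r, support r = enum_val k & lone r]].
have Av k : A (v k) by rewrite /v; case: xgetP => // x _ [].
exists #|{set 'I_M}|, v; apply/seteqP; split; last first.
  move=> _ [c [c0 c1] <-]; split; last first.
    rewrite /expect mulmx_suml; under eq_bigr do
      rewrite -scalemxAl (proj2 (Av _)).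
    by rewrite -scaler_suml c1 scale1r.
  split=> [i|].
    rewrite summxE sumr_ge0 // => k _; rewrite !mxE mulr_ge0 //.
    exact: (proj1 (proj1 (Av k))).
  under eq_bigr do rewrite summxE.
  rewrite exchange_big /=.
  under eq_bigr => k _ do (under eq_bigr do rewrite mxE;
    rewrite -mulr_sumr (proj2 (proj1 (Av k))) mulr1).
  exact: c1.
(* Induction on a bound for the size of the support; an empty support contradicts total mass 1. *)
move=> /= r; move: {2}#|_| (leqnn #|support r|) => n.
elim: n r => [|n IHn] r rn Ar.
  exfalso; have [[r0 r1] _] := Ar.
  move: rn; rewrite leqn0 cards_eq0 => /eqP s0.
  move/eqP: r1; rewrite big1 1?eq_sym ?oner_eq0 // => i _.
  by move/setP/(_ i): s0; rewrite !inE => /negbFE/eqP.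
have [lr|] := pselect (lone r).
  suff <- : v (enum_rank (support r)) = r.
    exists (delta_mx 0 (enum_rank (support r))); last exact: expect_delta.
    exact: is_distr_delta.
  rewrite /v enum_rankK; case: xgetP => [x _ [Ax sx lx]|/(_ r) []//].
  by apply: lr => //; rewrite sx.
move=> /existsNP[s /not_implyP[As /not_implyP[srs sr]]].
(* The direction [u] is nonzero, has coordinate sum 0 and is killed by [C]. Hence [u] and [- u] both
   have a negative coordinate, and the boundary is reached from [r] both ways without leaving
   [A]. *)
pose u := s - r.
have [[r0 r1] rC] := Ar; have [[s0 s1] sC] := As.
have ru i : r 0 i = 0 -> u 0 i = 0.
  move=> ri; rewrite !mxE ri subr0; apply/eqP.
  move/fintype.subsetP/(_ i): srs; rewrite !inE ri eqxx.
  by case: eqP => // _ /(_ isT).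
have u1 : \sum_i u 0 i = 0.
  by under eq_bigr do rewrite !mxE; rewrite sumrB r1 s1 subrr.
have uC : u *m C = 0 by rewrite mulmxBl rC sC subrr.
have neg (x : 'rV[R]_M) : \sum_i x 0 i = 0 -> x != 0 -> exists i, x 0 i < 0.
  move=> x1 xn0; have [//|nx] := pselect (exists i, x 0 i < 0).
  case/eqP: xn0; apply/rowP => i.
  have x0 j : 0 <= x 0 j.
    by rewrite leNgt; apply/negP => xj; apply: nx; exists j.
  move: x1 => /eqP; rewrite psumr_eq0 // => /allP/(_ i).
  by rewrite mem_index_enum => /(_ isT)/eqP ->; rewrite mxE.
have un0 : u != 0 by rewrite subr_eq0; apply/eqP.
have stay t (x : 'rV[R]_M) : \sum_i x 0 i = 0 -> x *m C = 0 ->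
    (forall i, 0 <= (r + t *: x) 0 i) -> A (r + t *: x).
  move=> x1 xC p; split; last by rewrite mulmxDl -scalemxAl xC scaler0 addr0.
  split=> //; under eq_bigr do rewrite !mxE.
  by rewrite big_split /= -mulr_sumr x1 mulr0 addr0.
have Nu1 : \sum_i (- u) 0 i = 0.
  by under eq_bigr do rewrite mxE; rewrite sumrN u1 oppr0.
have NuC : (- u) *m C = 0 by rewrite mulNmx uC oppr0.
have [t t0 [rt pt]] := move_to_boundary r0 ru (neg _ u1 un0).
have [||z z0 [rz pz]] := @move_to_boundary _ _ r (- u) r0.
- by move=> i /ru; rewrite !mxE => ->; rewrite oppr0.
- by apply: neg; rewrite ?oppr_eq0.
have hull x : support x \proper support r -> A x -> conv_hull v x.
  by move=> /proper_card xr; apply: IHn; rewrite -ltnS (leq_trans xr).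
have tz : t + z != 0 by rewrite gt_eqF ?addr_gt0.
(* The weights are chosen so that the displacements [t *: u] and [z *: - u] cancel. *)
have -> : r = (z / (t + z)) *: (r + t *: u) + (t / (t + z)) *: (r + z *: - u).
  by apply/rowP => i; rewrite !mxE; field.
apply: (@conv_hull_convex _ _ _ v (z / (t + z)) (t / (t + z))
  (r + t *: u) (r + z *: - u)).
- by rewrite divr_ge0 ?addr_ge0 ?ltW.
- by rewrite divr_ge0 ?addr_ge0 ?ltW.
- by rewrite -mulrDl addrC divff // addrC.
- by apply: hull => //; exact: stay.
- by apply: hull => //; exact: stay.
Qed.

(** * Dot product on row vectors *)

Section dot_product.
Variables (R : realType) (d : nat).
Implicit Types u v x y : 'rV[R]_d.

Lemma dotvC u v : dotv u v = dotv v u.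
Proof. by apply: eq_bigr => k _; rewrite mulrC. Qed.

Lemma dotvDr u x y : dotv u (x + y) = dotv u x + dotv u y.
Proof.
by rewrite -big_split /=; apply: eq_bigr => k _; rewrite mxE mulrDr.
Qed.

Lemma dotvZr u (a : R) x : dotv u (a *: x) = a * dotv u x.
Proof. by rewrite mulr_sumr; apply: eq_bigr => k _; rewrite mxE mulrCA. Qed.

Lemma dotv0 u : dotv u 0 = 0.
Proof. by apply: big1 => k _; rewrite mxE mulr0. Qed.

Lemma dotv_delta u k : dotv u (delta_mx 0 k) = u 0 k.
Proof.
rewrite /dotv (bigD1 k) //= big1 ?addr0 => [|i /negPf ik].
  by rewrite mxE !eqxx mulr1.
by rewrite mxE ik mulr0.
Qed.

(** Turns the quadratic penalty into a polynomial in [t] along a coordinate line, ready for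
    differentiation. *)
Lemma dotvv_move u k (t : R) : let v := u + t *: delta_mx 0 k in
  dotv v v = dotv u u + t * (2 * u 0 k) + t ^+ 2.
Proof.
rewrite /= dotvDr dotvZr dotv_delta dotvC dotvDr dotvZr dotv_delta.
by rewrite !mxE !eqxx /=; ring.
Qed.

Lemma dotvv_ge0 u : 0 <= dotv u u.
Proof. by apply: sumr_ge0 => k _; rewrite -expr2 sqr_ge0. Qed.

Lemma sqr_coord_le_dotvv u k : u 0 k ^+ 2 <= dotv u u.
Proof.
rewrite /dotv (bigD1 k) //= expr2 lerDl.
by apply: sumr_ge0 => i _; rewrite -expr2 sqr_ge0.
Qed.

Lemma dotv_expect (M : nat) (p : 'rV[R]_M) (w : 'I_M -> 'rV[R]_d) v :
  dotv (expect p w) v = \sum_i p 0 i * dotv (w i) v.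
Proof.
rewrite /dotv /expect; under eq_bigr do rewrite summxE mulr_suml.
rewrite exchange_big /=; apply: eq_bigr => i _; rewrite mulr_sumr.
by apply: eq_bigr => k _; rewrite mxE mulrA.
Qed.

End dot_product.

(** * Continuity and compactness *)

Lemma continuous_sum (R : realType) (T : topologicalType) (I : finType)
  (F : I -> T -> R) :
  (forall i, continuous (F i)) -> continuous (fun x => \sum_i F i x).
Proof.
by move=> cF; apply: continuous_big => [x|i _]; [exact: add_continuous|].
Qed.

Lemma continuous_dotv (R : realType) (d : nat) (T : topologicalType)
  (f g : T -> 'rV[R]_d) :
  continuous f -> continuous g -> continuous (fun x => dotv (f x) (g x)).
Proof.
move=> cf cg; apply: continuous_sum => k x.
have coord (h : T -> 'rV[R]_d) :
    continuous h -> {for x, continuous (fun x => h x 0 k)}.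
  move=> ch; apply: (@continuous_comp _ _ _ h (fun M : 'rV[R]_d => M 0 k)).
    exact: ch.
  exact: coord_continuous.
by apply: continuousM; exact: coord.
Qed.

(* Since ln x = 0 for x <= 0, continuity holds on the whole line. *)
Lemma continuous_xlnx (R : realType) : continuous (fun x : R => x * ln x).
Proof.
move=> x; have [x0|x0|->] := ltgtP x 0.
- apply: (@cvg_trans _ (cst (x * ln x) @ nbhs x)); last exact: cvg_cst.
  apply: near_eq_cvg; near=> y.
  have y0 : y <= 0 by near: y; exact: lt_le_nbhsl.
  by rewrite /= !ln0 ?mulr0 // ltW.
- by apply: continuousM => //; exact: continuous_ln.
rewrite /continuous_at mul0r.
(* Squeeze at 0 by the square root. For 0 < y <= 1 and s = sqrt y, y ln y = 2 s (s ln s), and -1 < s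
   ln s <= 0 because ln (1/s) < 1/s. *)
have sqrt0 : 2 * Num.sqrt y @[y --> (0 : R)] --> (0 : R).
  rewrite [X in _ --> X](_ : _ = 2 * Num.sqrt 0); last by rewrite sqrtr0 mulr0.
  by apply: cvgM; [exact: cvg_cst | exact: sqrt_continuous].
apply: (@squeeze_cvgr _ _ _ _ (fun y : R => - (2 * Num.sqrt y))
  (fun y : R => 2 * Num.sqrt y)).
- near=> y; have [y0|y0] := leP y 0.
    by rewrite ln0 // mulr0 ler0_sqrtr // mulr0 oppr0 lexx.
  have y1 : y <= 1 by near: y; exact: (lt_le_nbhsl ltr01).
  set s := Num.sqrt y; have s0 : 0 < s by rewrite sqrtr_gt0.
  have ys : y = s ^+ 2 by rewrite sqr_sqrtr // ltW.
  have lns : ln s^-1 < s^-1 by rewrite ln_sublinear // invr_gt0.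
  rewrite lnV ?posrE // in lns.
  have ln0s : ln y <= 0 by rewrite ln_le0.
  have lny : ln y = 2 * ln s by rewrite ys lnXn // mulr_natl.
  have sl1 : -1 < s * ln s.
    rewrite ltrNl -mulrN -[ltRHS](@divff _ s) ?gt_eqF //.
    by rewrite ltr_pM2l.
  have sl0 : s * ln s <= 0 by rewrite pmulr_rle0 //; lra.
  have -> : y * ln y = 2 * (s * (s * ln s)) by rewrite lny {1}ys; ring.
  by apply/andP; split; nra.
- by rewrite -[X in _ --> X]oppr0; exact: cvgN.
- exact: sqrt0.
Unshelve. all: by end_near.
Qed.

Lemma continuous_entropy (R : realType) (M : nat) :
  continuous (@entropy R M).
Proof.
move=> p; apply: continuousN; apply: continuous_sum => i q.
apply: (@continuous_comp _ _ _ (fun M : 'rV[R]_M => M 0 i)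
  (fun x : R => x * ln x)); first exact: coord_continuous.
exact: continuous_xlnx.
Qed.

Lemma continuous_expect (R : realType) (M d : nat) (w : 'I_M -> 'rV[R]_d) k :
  continuous (fun q => expect q w 0 k).
Proof.
have -> : (fun q => expect q w 0 k) = (fun q => \sum_i q 0 i * w i 0 k).
  by apply/funext => q; rewrite summxE; apply: eq_bigr => i _; rewrite mxE.
apply: continuous_sum => i q; apply: continuousM; first exact: coord_continuous.
exact: cst_continuous.
Qed.

Lemma compact_box (R : realType) (n : nat) (a b : R) :
  compact [set v : 'rV[R]_n | forall i, v ord0 i \in `[a, b]].
Proof.
apply: (@rV_compact _ _ (fun=> `[a, b]%classic)) => i; exact: segment_compact.
Qed.

(** The simplex is a closed slice of the unit cube: nonnegative coordinates with sum 1 are at most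
    1. *)
Lemma compact_simplex (R : realType) (M : nat) :
  compact [set p : 'rV[R]_M | is_distr p].
Proof.
have -> : [set p : 'rV[R]_M | is_distr p] =
    [set p : 'rV[R]_M | forall i, p ord0 i \in `[0, 1]] `&`
    (fun p : 'rV[R]_M => \sum_i p 0 i) @^-1` [set x | x = 1].
  apply/seteqP; split=> p /=.
    move=> [p0 p1]; split=> // i; rewrite in_itv /= p0 -p1 (bigD1 i) //= lerDl.
    exact: sumr_ge0.
  by move=> [p01 p1]; split=> // i; have := p01 i; rewrite in_itv => /andP[].
apply: compact_closedI; first exact: compact_box.
apply: preimage_closed => [p _|]; last exact: closed_eq.
apply: continuous_sum => i q; exact: coord_continuous.
Qed.

(** * Derivatives along a line *)

Lemma is_derive_affine (R : realType) (a b t : R) :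
  is_derive t 1 (fun s => a + s * b) b.
Proof.
apply: (@is_derive_eq _ _ _ (cst a + id * cst b)).
by rewrite scaler0 !add0r /GRing.scale /= mulr1.
Qed.

Lemma is_derive_sum_expR (R : realType) (M : nat) (a b : 'I_M -> R) (t : R) :
  is_derive t 1 (fun s => \sum_j expR (a j + s * b j))
    (\sum_j expR (a j + t * b j) * b j).
Proof.
rewrite -(fct_sumE _ _ (fun j s => expR (a j + s * b j))).
apply: is_derive_sum => j.
apply: (@is_derive1_comp _ expR (fun s => a j + s * b j)).
exact: is_derive_affine.
Qed.

(** * Gibbs' inequality *)

(** This is ln z <= z - 1 at z = y / x, multiplied by x; for x = 0 it reduces to 0 <= y. *)
Lemma xlny_le (R : realType) (x y : R) : 0 <= x -> 0 < y ->
  x * ln y <= x * ln x + (y - x).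
Proof.
move=> x0 y0; have [->|xn0] := eqVneq x 0.
  by rewrite !mul0r add0r subr0 ltW.
have xp : 0 < x by rewrite lt_neqAle eq_sym xn0.
have yx : 0 < y / x by rewrite divr_gt0.
have : ln (y / x) <= y / x - 1.
  by rewrite -{1}[y / x](subrK 1) addrC le_ln1Dx // ltrBrDr addNr.
rewrite ln_div ?posrE // -(ler_pM2l xp) !mulrBr mulr1.
by rewrite mulrCA divff // mulr1 lerBlDl.
Qed.

Lemma cross_entropy_pos (R : realType) (M : nat) (p q : 'rV[R]_M) :
  (forall i, 0 < q 0 i) ->
  cross_entropy p q = (- \sum_i p 0 i * ln (q 0 i))%:E.
Proof.
move=> q0; rewrite /cross_entropy EFinN -sumEFin; congr (- _)%E.
by apply: eq_bigr => i _; rewrite lne_EFin // EFinM.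
Qed.

Lemma entropy_le_cross_entropy (R : realType) (M : nat) (p q : 'rV[R]_M) :
  is_distr p -> is_distr q -> ((entropy p)%:E <= cross_entropy p q)%E.
Proof.
move=> [p0 p1] [q0 q1]; rewrite /entropy /cross_entropy EFinN leeN2.
(* Both masses are 1, so adding the differences [q 0 i - p 0 i] changes nothing in total and makes
   the inequality hold term by term. *)
have -> : \sum_i p 0 i * ln (p 0 i) =
    \sum_i (p 0 i * ln (p 0 i) + (q 0 i - p 0 i)).
  by rewrite big_split /= sumrB p1 q1 subrr addr0.
rewrite -sumEFin; apply: lee_sum => i _.
have := q0 i; rewrite le_eqVlt => /predU1P[<-|qi]; last first.
  by rewrite lne_EFin // -EFinM lee_fin xlny_le.
(* Here [q 0 i] is 0: the term vanishes on both sides if [p 0 i] is 0, and is -oo on the smaller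
   side otherwise. *)
rewrite le0_lneNy //; have := p0 i; rewrite le_eqVlt => /predU1P[<-|pi].
  by rewrite mul0e mul0r subrr addr0.
by rewrite gt0_muleNy ?lte_fin // leNye.
Qed.

(** * The Gibbs family and its loss *)

Lemma sum_expR_gt0 (R : realType) (M : nat) (a : 'I_M.+1 -> R) :
  0 < \sum_j expR (a j).
Proof.
by rewrite big_ord_recl ltr_pwDl ?expR_gt0 // sumr_ge0 // => i _;
  exact: expR_ge0.
Qed.

Section gibbs_family.
Variables (R : realType) (M d : nat) (w : 'I_M.+1 -> 'rV[R]_d).
Implicit Types (h : 'rV[R]_d) (p q : 'rV[R]_M.+1).

Definition partition_fun h : R := \sum_j expR (dotv (w j) h).

Lemma partition_fun_gt0 h : 0 < partition_fun h.
Proof. exact: sum_expR_gt0. Qed.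

Lemma gibbs_gt0 h i : 0 < gibbs w h 0 i.
Proof. by rewrite mxE divr_gt0 ?expR_gt0 // partition_fun_gt0. Qed.

Lemma gibbs_distr h : is_distr (gibbs w h).
Proof.
split=> [i|]; first exact/ltW/gibbs_gt0.
under eq_bigr do rewrite mxE.
by rewrite -mulr_suml divff // gt_eqF // partition_fun_gt0.
Qed.

(* H(p, Q_h), which depends on p only through E_p[w]. *)
Definition loss p h : R := ln (partition_fun h) - dotv (expect p w) h.

(** The logarithm of a Gibbs weight is [dotv (w i) h] minus the log-partition function, and the
    latter is averaged with total mass 1. *)
Lemma sum_ln_gibbs p h : is_distr p ->
  - \sum_i p 0 i * ln (gibbs w h 0 i) = loss p h.
Proof.
move=> [_ p1]; rewrite /loss dotv_expect.
under eq_bigr => i _ do rewrite mxE ln_div ?posrE ?expR_gt0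
  ?partition_fun_gt0 // expRK mulrBr.
by rewrite sumrB -mulr_suml p1 mul1r opprB.
Qed.

Lemma cross_entropy_gibbs p h : is_distr p ->
  cross_entropy p (gibbs w h) = (loss p h)%:E.
Proof.
move=> pd; rewrite cross_entropy_pos ?sum_ln_gibbs //; exact: gibbs_gt0.
Qed.

Lemma entropy_le_loss p h : is_distr p -> entropy p <= loss p h.
Proof.
move=> pd; rewrite -lee_fin -cross_entropy_gibbs //.
exact: entropy_le_cross_entropy (gibbs_distr h).
Qed.

Lemma entropy_gibbs h : entropy (gibbs w h) = loss (gibbs w h) h.
Proof. by rewrite -sum_ln_gibbs //; exact: gibbs_distr. Qed.

Lemma continuous_loss p : continuous (loss p).
Proof.
have cdot u : continuous (dotv u : 'rV[R]_d -> R).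
  by apply: continuous_dotv => x; [exact: cst_continuous | exact: cvg_id].
move=> h.
apply: (@continuousB _ _ _ (fun h => ln (partition_fun h))
  (dotv (expect p w))); last exact: cdot.
apply: (@continuous_comp _ _ _ partition_fun (@ln R)); last first.
  exact/continuous_ln/partition_fun_gt0.
apply: continuous_sum => j x.
apply: (@continuous_comp _ _ _ (dotv (w j)) (@expR R)); first exact: cdot.
exact: continuous_expR.
Qed.

(** * The regularised loss and its minimiser *)

Definition ridge p (e : R) h : R := loss p h + e / 2 * dotv h h.

(** The loss is bounded below by [entropy p], so the quadratic term pushes the value outside a large
    box above the value at 0; inside the box the extreme value theorem applies. *)
Lemma ridge_attains_min p (e : R) : is_distr p -> 0 < e ->
  exists h, forall x, ridge p e h <= ridge p e x.
Proof.
move=> pd e0; set K := loss p 0 - entropy p.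
have K0 : 0 <= K by rewrite subr_ge0 entropy_le_loss.
(* This gives e/2 * B >= K, and B >= 1 gives |x|^2 >= B^2 >= B outside the box, so the penalty there
   is at least [K]. *)
pose B := 1 + 2 * K / e.
have B1 : 1 <= B by rewrite lerDl divr_ge0 ?mulr_ge0 // ltW.
pose box : set 'rV[R]_d := [set x | forall i, x ord0 i \in `[- B, B]].
have box0 : box 0 by move=> i; rewrite /= mxE in_itv /=; lra.
have [h hbox hmin] : exists2 h, h \in box &
    forall x, x \in box -> ridge p e h <= ridge p e x.
  apply: EVT_min_rV; first by exists 0.
    exact: compact_box.
  apply: continuous_subspaceT => x.
  apply: (@continuousD _ _ _ (loss p) (fun x => e / 2 * dotv x x)).
    exact: continuous_loss.
  apply: continuousM; first exact: cst_continuous.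
  by apply: continuous_dotv => y; exact: cvg_id.
exists h => x; have [xbox|] := pselect (box x).
  by apply: hmin; rewrite inE.
move=> /existsNP[i]; rewrite /= in_itv /= -ler_norml => /negP.
rewrite -ltNge => Bx.
have /le_trans -> // : ridge p e h <= ridge p e 0 by apply: hmin; rewrite inE.
have xx : B <= dotv x x.
  apply: le_trans (sqr_coord_le_dotvv x i); rewrite -real_normK ?num_real //.
  nra.
have KB : K <= e / 2 * B.
  have -> : e / 2 * B = e / 2 + K by rewrite /B; field; rewrite gt_eqF.
  lra.
have eB : e / 2 * B <= e / 2 * dotv x x by rewrite ler_pM2l //; lra.
rewrite /ridge; have := entropy_le_loss x pd.
rewrite !dotv0 mulr0.
move: KB; rewrite /K; lra.
Qed.

Lemma ridge_stationary p (e : R) h :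
  (forall x, ridge p e h <= ridge p e x) ->
  expect (gibbs w h) w = expect p w - e *: h.
Proof.
move=> hmin; apply/rowP => k; rewrite [RHS]mxE [X in _ + X]mxE [X in _ - X]mxE.
pose line t := h + t *: delta_mx 0 k.
(* The ridge along the [k]-th coordinate line through [h], expanded so that its derivative [dphi]
   can be read off. *)
pose phi (t : R) : R := ln (\sum_j expR (dotv (w j) h + t * w j 0 k))
  - (dotv (expect p w) h + t * expect p w 0 k)
  + e / 2 * (dotv h h + t * (2 * h 0 k) + t ^+ 2).
have phiE t : phi t = ridge p e (line t).
  rewrite /phi /ridge /loss /partition_fun /line.
  under [in RHS]eq_bigr do rewrite dotvDr dotvZr dotv_delta.
  by rewrite dotvv_move dotvDr dotvZr dotv_delta.
pose dphi (t : R) : R := (\sum_j expR (dotv (w j) h + t * w j 0 k))^-1 *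
   (\sum_j expR (dotv (w j) h + t * w j 0 k) * w j 0 k)
  - expect p w 0 k + e / 2 * (2 * h 0 k + 2 * t).
have dphiP (t : R) : is_derive t 1 phi (dphi t).
  apply: is_deriveD; last first.
    apply: (@is_derive_eq _ _ _ (cst (e / 2) *
      (cst (dotv h h) + id * cst (2 * h 0 k) + id ^+ 2))).
    rewrite /GRing.scale /= expr1; ring.
  apply: is_deriveB; last exact: is_derive_affine.
  apply: (@is_derive1_comp _ (@ln R)); last exact: is_derive_sum_expR.
  exact/is_derive1_ln/sum_expR_gt0.
(* Fermat's rule at the interior minimum t = 0; comparison with [dphi 0] then gives the [k]-th
   coordinate of the stationarity equation. *)
have [_] : is_derive (0 : R) 1 phi 0.
  apply: (@derive1_at_min _ phi (-1) 1 0); first lra.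
  - by move=> t _; exact: ex_derive.
  - by rewrite in_itv /=; lra.
  - by move=> t _; rewrite !phiE /line scale0r addr0; exact: hmin.
have [_ ->] := dphiP 0.
rewrite /dphi.
under eq_bigr do rewrite mul0r addr0.
under [X in _ * X]eq_bigr do rewrite mul0r addr0.
rewrite -/(partition_fun h) => d0.
have -> : expect (gibbs w h) w 0 k =
    (partition_fun h)^-1 * \sum_j expR (dotv (w j) h) * w j 0 k.
  rewrite summxE mulr_sumr; apply: eq_bigr => j _.
  by rewrite !mxE mulrCA mulrA.
lra.
Qed.

(** At the ridge minimiser, stationarity gives H(q) = [loss p h] + e |h|^2 and a gap of - e h.
    Comparing the ridge at [h] and at 0 yields e/2 |h|^2 <= [loss p 0 - entropy p], hence the bound
    on e^2 |h|^2. *)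
Lemma near_max_entropy p (e : R) : is_distr p -> 0 < e ->
  exists h, let q := gibbs w h in let g := expect q w - expect p w in
    loss p h <= entropy q /\ dotv g g <= e * (2 * (loss p 0 - entropy p)).
Proof.
move=> pd e0; have [h hmin] := ridge_attains_min pd e0; exists h => /=.
have st := ridge_stationary hmin.
split.
  rewrite entropy_gibbs /loss st lerD2l lerN2.
  rewrite dotvC dotvDr -scaleNr dotvZr dotvC gerDl mulNr oppr_le0.
  by rewrite mulr_ge0 ?dotvv_ge0 // ltW.
have -> : expect (gibbs w h) w - expect p w = (- e) *: h.
  by rewrite st addrAC subrr add0r scaleNr.
rewrite dotvZr dotvC dotvZr; have := hmin 0; rewrite /ridge.
rewrite !dotv0 mulr0 addr0.
have := entropy_le_loss h pd; nra.
Qed.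

(** * Strong duality *)

Lemma strong_duality p : is_distr p ->
  exists r, [/\ moment_polytope w p r,
    (forall s, moment_polytope w p s -> entropy s <= entropy r) &
    ereal_inf (range (fun h => cross_entropy p (gibbs w h))) = (entropy r)%:E].
Proof.
move=> pd; pose V := inf (range (loss p)).
have lb : has_lbound (range (loss p)).
  by exists (entropy p) => _ [h _ <-]; exact: entropy_le_loss.
have rn0 : range (loss p) !=set0 by exists (loss p 0), 0.
(* All cross entropies against Gibbs distributions are finite and bounded below, so the extended
   infimum is a real one. *)
have -> : ereal_inf (range (fun h => cross_entropy p (gibbs w h))) = V%:E.
  rewrite -ereal_inf_EFin // image_comp; congr ereal_inf.
  by apply: eq_imagel => h _; exact: cross_entropy_gibbs.
pose gap q := expect q w - expect p w.
(* A sum of two nonnegative defects: it vanishes exactly when the moment is right and the entropy is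
   at least [V]. Its minimum over the simplex is attained, and near-maximisers make it arbitrarily
   small, so the minimum is 0. *)
pose f q := dotv (gap q) (gap q) + Num.max 0 (V - entropy q).
have [r] : exists2 r, r \in [set p : 'rV[R]_M.+1 | is_distr p] &
    forall q, q \in [set p : 'rV[R]_M.+1 | is_distr p] -> f r <= f q.
  apply: EVT_min_rV; [by exists p | exact: compact_simplex |].
  apply: continuous_subspaceT => q.
  apply: (@continuousD _ _ _ (fun q => dotv (gap q) (gap q))
    (fun q => Num.max 0 (V - entropy q))).
    apply: continuous_sum => k x.
    suff c : {for x, continuous (fun q => gap q 0 k)} by exact: continuousM.
    rewrite (_ : (fun q => _) = (fun q => expect q w 0 k - expect p w 0 k)).
      by apply: continuousB; [exact: continuous_expect | exact: cst_continuous].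
    by apply/funext => y; rewrite /gap !mxE.
  apply: continuous_max; first exact: cst_continuous.
  apply: continuousB; [exact: cst_continuous | exact: continuous_entropy].
rewrite inE => rd rmin.
have fr_small e : 0 < e -> f r <= e * (2 * (loss p 0 - entropy p)).
  move=> e0; have [h /= [le1 le2]] := near_max_entropy pd e0.
  apply: (le_trans (rmin (gibbs w h) _)).
    by rewrite inE; exact: gibbs_distr.
  rewrite /f max_l ?addr0 // subr_le0 (le_trans _ le1) //.
  by apply: ge_inf => //; exists h.
have fr0 : f r <= 0.
  apply/ler_addgt0Pr => e e0; rewrite add0r.
  have K0 : 0 <= loss p 0 - entropy p by rewrite subr_ge0 entropy_le_loss.
  (* The added 1 keeps the divisor positive when the difference is 0. *)
  pose K1 := 2 * (loss p 0 - entropy p) + 1.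
  have K1_gt0 : 0 < K1 by rewrite /K1; lra.
  apply: (le_trans (fr_small (e / K1) (divr_gt0 e0 K1_gt0))).
  rewrite -mulrA ger_pMr // mulrC ler_pdivrMr // /K1; lra.
have gap0 := dotvv_ge0 (gap r).
have max0 : 0 <= Num.max 0 (V - entropy r) by rewrite le_max lexx.
have mr : expect r w = expect p w.
  apply/eqP; rewrite -subr_eq0; apply/eqP/rowP => k; rewrite [RHS]mxE.
  apply/eqP; rewrite -sqrf_eq0 eq_le sqr_ge0 andbT.
  apply: (le_trans (sqr_coord_le_dotvv _ k)).
  by move: fr0; rewrite /f /gap; lra.
(* Weak duality: the loss sees a distribution only through its moment, so [loss p] and [loss s]
   agree. *)
have weak s : moment_polytope w p s -> entropy s <= V.
  move=> [sd ms]; apply: lb_le_inf => // _ [h _ <-].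
  by rewrite /loss -ms; exact: entropy_le_loss.
have Vr : V <= entropy r.
  rewrite -subr_le0; apply: le_trans (_ : Num.max 0 (V - entropy r) <= 0).
    by rewrite le_max lexx orbT.
  by move: fr0; rewrite /f; lra.
exists r; split=> [|s /weak sV|]; first by split.
  exact: le_trans Vr.
by congr EFin; apply/eqP; rewrite eq_le Vr weak.
Qed.

End gibbs_family.

(** * Linear description of the moment polytope and conclusion *)

Lemma mulmx_expect (R : realType) (M d : nat) (r : 'rV[R]_M)
  (w : 'I_M -> 'rV[R]_d) : r *m (\matrix_i w i) = expect r w.
Proof. by rewrite mulmx_sum_row; apply: eq_bigr => i _; rewrite rowK. Qed.

(** A column of ones encodes total mass 1, and the [d] coordinates of the vectors [w i] supply the
    other columns. *)
Lemma moment_polytope_linear (R : realType) (M d : nat)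
  (w : 'I_M -> 'rV[R]_d) (p : 'rV[R]_M) :
  @defined_by_linear_constraints R M d.+1 (moment_polytope w p).
Proof.
pose C : 'M[R]_(M, 1 + d) := row_mx (const_mx 1) (\matrix_i w i).
pose b : 'rV[R]_(1 + d) := row_mx 1%:M (expect p w).
have constr (r : 'rV[R]_M) :
    r *m C = b <-> \sum_i r 0 i = 1 /\ expect r w = expect p w.
  rewrite mul_mx_row mulmx_expect.
  have -> : r *m const_mx 1 = (\sum_i r 0 i)%:M.
    apply/matrixP => i j; rewrite !ord1 [LHS]mxE mxE eqxx mulr1n.
    by apply: eq_bigr => k _; rewrite mxE mulr1.
  split=> [/eq_row_mx[/matrixP/(_ 0 0)]|[-> ->] //].
  by rewrite mxE [RHS]mxE eqxx !mulr1n.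
exists C, b; apply/seteqP; split=> r /=.
  by move=> [[r0 r1] rm]; split=> //; apply/constr.
by move=> [r0 /constr[r1 rm]]; split.
Qed.

Theorem theorem2 (R : realType) (M d : nat) (M_ge1 : (1 <= M)%N)
    (d_ge1 : (1 <= d)%N) (w : 'I_M -> 'rV[R]_d) (pstar : 'rV[R]_M)
    (pstar_distr : is_distr pstar) :
  (forall q : 'rV[R]_M, is_distr q ->
     ((entropy pstar)%:E <= cross_entropy pstar q)%E) /\
  (exists rmax : 'rV[R]_M,
     [/\ moment_polytope w pstar rmax,
         (forall r : 'rV[R]_M, moment_polytope w pstar r ->
            entropy r <= entropy rmax) &
         ereal_inf (range (fun h : 'rV[R]_d => cross_entropy pstar (gibbs w h)))
           = (entropy rmax)%:E]) /\
  convex_polytope (moment_polytope w pstar) /\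
  @defined_by_linear_constraints R M d.+1 (moment_polytope w pstar).
Proof.
(* Writing the size as a successor makes the index type visibly nonempty, so partition functions are
   positive. *)
case: M M_ge1 w pstar pstar_distr => // M' _ w pstar pd.
split; first by move=> q; exact: entropy_le_cross_entropy.
split; first exact: strong_duality.
split; last exact: moment_polytope_linear.
rewrite (_ : moment_polytope w pstar =
    [set r | is_distr r /\ r *m \matrix_i w i = expect pstar w]).
  by apply: constrained_distr_polytope pd _; exact: mulmx_expect.
by apply/seteqP; split=> r /=; rewrite mulmx_expect.
Qed.
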